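(* Let $\mathbf C$ be a topological category, $G=G'\times M_1\times\cdots\times M_r$ with $G'$ a topologised group and $M_i$ abelian topologised monoids, $D$ a discrete abelian monoid in $\mathbf C$, and $(A,h_A)$ a $D\times G$-module with $\mathbf C$-rigidification such that $D$ is $A$-pliant. Then there is a quasi-isomorphism of complexes $C^\bullet(D\times G,A)\to\mathrm{tot}\,C^{\bullet,\bullet}$, where $C^{p,q}=C^p(D,C^q(G,A))$.
   Context: A concrete category is a category with a faithful functor $\mathfrak z:\mathbf C\to\mathbf{Set}$; it admits discrete objects if it has finite limits and $\mathfrak z$ has a fully faithful left adjoint $\mathbf F$. An object $X$ is discrete if $\mathfrak z:\mathrm{Hom}(X,Y)\to\mathrm{Hom}_{\mathbf{Set}}(\mathfrak zX,\mathfrak zY)$ is bijective for all $Y$. $\bullet$ is a one-point set. $\mathbf C$ is topological if $\mathbf F$ commutes with finite limits and for every discrete $D$ and all $X,Y$ the natural map $\mathrm{Hom}(D\times X,Y)\to\mathrm{Hom}_{\mathbf{Set}}(\mathfrak zD,\mathrm{Hom}(X,Y))$ is bijective. Topologised groups/monoids are group/monoid objects in $\mathbf C$; a discrete abelian monoid is a monoid object whose underlying object is discrete and whose underlying monoid is abelian. A $K$-module with $\mathbf C$-rigidification is a pair $(A,h_A)$ of an abelian group $A$ with $\mathfrak zK$-module structure and a functor $h_A:\mathbf C^{\mathrm{op}}\to\mathbf{Set}$ with $h_A(X)$ a subgroup of $\mathrm{Hom}_{\mathbf{Set}}(\mathfrak zX,A)$ functorially in $X$, $h_A(\mathbf F\bullet)=A$,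 such that for $f\in h_A(X)$ the map $(k,x)\mapsto k\cdot f(x)$ lies in $h_A(K\times X)$. A discrete object $D$ is $A$-pliant if $h_A(D\times X)=\mathrm{Hom}_{\mathbf{Set}}(\mathfrak zD,h_A(X))$ for all $X$. $A$ is regarded as a $G$-module with $\mathbf C$-rigidification by restriction along $G\to D\times G$. $C^n(K,A)$ denotes normalised cochains: $f\in h_A(K^n)$ with $f=0$ whenever an argument equals $1$, with differential $\partial f(x_1,\dots,x_{n+1})=x_1f(x_2,\dots,x_{n+1})+\sum_{i=1}^n(-1)^if(\dots,x_ix_{i+1},\dots)+(-1)^{n+1}f(x_1,\dots,x_n)$. $D$ acts on $C^q(G,A)$ by $(df)(\underline x)=d\cdot f(\underline x)$. $C^p(D,C^q(G,A))$ is the set of maps $(\mathfrak zD)^p\to C^q(G,A)$ vanishing when some argument is $1$; it is a double complex with horizontal differential $\delta f(y_1,\dots,y_{p+1})=y_1f(y_2,\dots,y_{p+1})+\sum_{i=1}^p(-1)^if(\dots,y_iy_{i+1},\dots)+(-1)^{p+1}f(y_1,\dots,y_p)$ and vertical differential $\partial$ applied to values. $\mathrm{tot}$ has $n$-th term $\bigoplus_{p+q=n}C^{p,q}$ and differential $\Delta=\partial+(-1)^q\delta$ on $C^{p,q}$. *)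

(* Defs.v *)
From HB Require Import structures.
From mathcomp Require Import all_boot all_algebra.
Set Implicit Arguments. Unset Strict Implicit. Unset Printing Implicit Defensive.
Import GRing.Theory.
Local Open Scope ring_scope.

(* Topological categories, encoded as concrete categories of structured sets *)
(* .  An object is a pair (T, s : Str T); z(T,s) = T; *)
(* morphisms are the functions f with hom s t f (faithfulness of z).         *)
(* Finite limits are given by a terminal object, binary products and         *)
(* equalizers whose carriers are the set-theoretic limits (z is a right      *)
(* adjoint, hence preserves limits).  The fully faithful left adjoint F is   *)
(* S |-> (S, sdisc S).                                                       *)
Unset Implicit Arguments.
Record TopCat := {
  Str : Type -> Type;
  hom : forall T U : Type, Str T -> Str U -> (T -> U) -> Prop;
  hom_id : forall T (s : Str T), hom T T s s (fun x => x);
  hom_comp : forall T U V (s : Str T) (t : Str U) (u : Str V) (f : T -> U) (g : U -> V),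
      hom T U s t f -> hom U V t u g -> hom T V s u (fun x => g (f x));
  sunit : Str unit;
  hom_tt : forall T (s : Str T), hom T unit s sunit (fun _ => tt);
  sprod : forall T U, Str T -> Str U -> Str (T * U);
  hom_fst : forall T U (s : Str T) (t : Str U), hom (T * U) T (sprod T U s t) s fst;
  hom_snd : forall T U (s : Str T) (t : Str U), hom (T * U) U (sprod T U s t) t snd;
  hom_pair : forall Z T U (z : Str Z) (s : Str T) (t : Str U) (f : Z -> T) (g : Z -> U),
      hom Z T z s f -> hom Z U z t g -> hom Z (T * U) z (sprod T U s t) (fun x => (f x, g x));
  seqz : forall T U (s : Str T) (t : Str U) (f g : T -> U), Str {x : T | f x = g x};
  hom_incl : forall T U (s : Str T) (t : Str U) (f g : T -> U),
      hom T U s t f -> hom T U s t g ->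
      hom {x : T | f x = g x} T (seqz T U s t f g) s (@proj1_sig T _);
  hom_lift : forall Z T U (z : Str Z) (s : Str T) (t : Str U) (f g : T -> U) (h : Z -> T)
      (e : forall x, f (h x) = g (h x)),
      hom T U s t f -> hom T U s t g -> hom Z T z s h ->
      hom Z {x : T | f x = g x} z (seqz T U s t f g)
        (fun x => exist (fun y => f y = g y) (h x) (e x));
  sdisc : forall T, Str T;
  hom_disc : forall T U (t : Str U) (f : T -> U), hom T U (sdisc T) t f;
  (* F commutes with finite limits *)
  disc_tt : hom unit unit sunit (sdisc unit) (fun x => x);
  disc_prod : forall T U,
      hom (T * U) (T * U) (sprod T U (sdisc T) (sdisc U)) (sdisc (T * U)) (fun x => x);
  disc_eqz : forall T U (f g : T -> U),
      hom {x : T | f x = g x} {x : T | f x = g x}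
        (seqz T U (sdisc T) (sdisc U) f g) (sdisc {x : T | f x = g x}) (fun x => x);
  (* Hom(D x X, Y) -> Hom_Set(zD, Hom(X,Y)) is bijective for discrete D *)
  hom_curry : forall D X Y (d : Str D) (x : Str X) (y : Str Y) (phi : D -> X -> Y),
      (forall V (v : Str V) (k : D -> V), hom D V d v k) ->
      (hom (D * X) Y (sprod D X d x) y (fun p => phi p.1 p.2) <->
       forall e, hom X Y x y (phi e))
}.
Set Implicit Arguments.

Arguments hom _ {T U}.
Arguments sprod _ {T U}.

Definition discrete (C : TopCat) T (s : Str C T) :=
  forall U (u : Str C U) (f : T -> U), hom C s u f.

Record MonData (C : TopCat) := {
  mT : Type; mS : Str C mT; mmul : mT -> mT -> mT; mone : mT }.
Arguments mT {C}. Arguments mS {C}. Arguments mmul {C}. Arguments mone {C}.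

Definition is_monoid_obj C (M : MonData C) :=
  [/\ (forall x y z, mmul M x (mmul M y z) = mmul M (mmul M x y) z),
      (forall x, mmul M (mone M) x = x),
      (forall x, mmul M x (mone M) = x),
      hom C (sprod C (mS M) (mS M)) (mS M) (fun p => mmul M p.1 p.2)
    & hom C (sunit C) (mS M) (fun _ => mone M)].

Definition is_group_obj C (M : MonData C) :=
  is_monoid_obj M /\
  exists inv : mT M -> mT M,
    (forall x, mmul M (inv x) x = mone M) /\ (forall x, mmul M x (inv x) = mone M) /\
    hom C (mS M) (mS M) inv.

Definition is_abelian_monoid_obj C (M : MonData C) :=
  is_monoid_obj M /\ forall x y, mmul M x y = mmul M y x.

Definition is_discrete_abelian_monoid C (M : MonData C) :=
  is_abelian_monoid_obj M /\ discrete (mS M).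

Definition prodMon C (M N : MonData C) : MonData C :=
  {| mT := (mT M * mT N)%type; mS := sprod C (mS M) (mS N);
     mmul := fun x y => (mmul M x.1 y.1, mmul N x.2 y.2);
     mone := (mone M, mone N) |}.

Definition prodMons C (G' : MonData C) (Ms : seq (MonData C)) : MonData C :=
  foldl (@prodMon C) G' Ms.

Definition rigid_module C (K : MonData C) (A : zmodType) (act : mT K -> A -> A)
    (h : forall T, Str C T -> (T -> A) -> Prop) :=
  ((forall k a b, act k (a + b) = act k a + act k b) /\
   (forall a, act (mone K) a = a) /\
   (forall k k' a, act (mmul K k k') a = act k (act k' a))) /\
  (* h_A(X) is a subgroup of Hom_Set(zX, A) *)
  (forall T (s : Str C T), h T s (fun _ => 0) /\
     forall f g, h T s f -> h T s g -> h T s (fun x => f x - g x)) /\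
  (forall T U (s : Str C T) (t : Str C U) (f : T -> U) (phi : U -> A),
     hom C s t f -> h U t phi -> h T s (fun x => phi (f x))) /\
  (* h_A(F bullet) = A *)
  (forall a : A, h unit (sdisc C unit) (fun _ => a)) /\
  (forall T (s : Str C T) (f : T -> A),
     h T s f -> h _ (sprod C (mS K) s) (fun p => act p.1 (f p.2))).

Definition pliant C (D : MonData C) (A : zmodType) (h : forall T, Str C T -> (T -> A) -> Prop) :=
  discrete (mS D) /\
  forall X (x : Str C X) (phi : mT D * X -> A),
    h _ (sprod C (mS D) x) phi <-> forall d, h X x (fun y => phi (d, y)).

(* K^n = ((1 x K) x K) ... x K ; the argument x_{i+1} is [pget one x i].     *)
Fixpoint powT (T : Type) (n : nat) : Type :=
  match n with 0 => unit | m.+1 => (powT T m * T)%type end.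

Fixpoint powS C T (s : Str C T) (n : nat) : Str C (powT T n) :=
  match n return Str C (powT T n) with 0 => sunit C | m.+1 => sprod C (@powS C T s m) s end.

Fixpoint pget T (one : T) (n : nat) : powT T n -> nat -> T :=
  match n return powT T n -> nat -> T with
  | 0 => fun _ _ => one
  | m.+1 => fun (p : powT T m * T) i => if i == m then p.2 else @pget T one m p.1 i
  end.

Fixpoint pmk T (n : nat) (y : nat -> T) : powT T n :=
  match n return powT T n with 0 => tt | m.+1 => (@pmk T m y, y m) end.
Arguments pmk {T} n y.
Arguments pget {T} one n _ _.
Arguments powS {C T} s n.

Definition sgn (A : zmodType) (i : nat) (a : A) : A := if odd i then - a else a.

Definition cdiff C (K : MonData C) (A : zmodType) (act : mT K -> A -> A) (n : nat)
    (f : powT (mT K) n -> A) : powT (mT K) n.+1 -> A :=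
  fun x =>
    let y := pget (mone K) n.+1 x in
    act (y 0%N) (f (pmk n (fun j => y j.+1)))
    + \sum_(1 <= i < n.+1)
        sgn i (f (pmk n (fun j => if (j < i.-1)%N then y j
                                  else if j == i.-1 then mmul K (y i.-1) (y i)
                                  else y j.+1)))
    + sgn n.+1 (f (pmk n y)).

Definition cochain C (K : MonData C) (A : zmodType)
    (h : forall T, Str C T -> (T -> A) -> Prop) (n : nat) (f : powT (mT K) n -> A) :=
  h _ (powS (mS K) n) f /\
  forall x, (exists i, (i < n)%N /\ pget (mone K) n x i = mone K) -> f x = 0.

Arguments cochain {C} K {A} h n f.

(* Cochain complexes of abelian groups (as subgroups of ambient groups) and  *)
(* quasi-isomorphisms                                                        *)
Unset Implicit Arguments.
Record cplx := {
  ctyp : nat -> Type;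
  cmem : forall n, ctyp n -> Prop;
  czero : forall n, ctyp n;
  cadd : forall n, ctyp n -> ctyp n -> ctyp n;
  copp : forall n, ctyp n -> ctyp n;
  cd : forall n, ctyp n -> ctyp n.+1 }.
Set Implicit Arguments.

Definition isbd (X : cplx) (n : nat) : ctyp X n -> Prop :=
  match n with
  | 0 => fun y => y = czero X 0
  | m.+1 => fun y => exists x, cmem X m x /\ cd X m x = y
  end.

Arguments isbd : clear implicits.

Definition quasi_iso (X Y : cplx) (phi : forall n, ctyp X n -> ctyp Y n) :=
  [/\
      (forall n x, cmem X n x -> cmem Y n (phi n x)),
      (forall n x x', cmem X n x -> cmem X n x' ->
         phi n (cadd X n x x') = cadd Y n (phi n x) (phi n x')),
      (forall n x, cmem X n x -> phi n.+1 (cd X n x) = cd Y n (phi n x)),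
      (forall n y, cmem Y n y -> cd Y n y = czero Y n.+1 ->
         exists x, [/\ cmem X n x, cd X n x = czero X n.+1 &
                       isbd Y n (cadd Y n y (copp Y n (phi n x)))])
    &
      (forall n x, cmem X n x -> cd X n x = czero X n.+1 ->
         isbd Y n (phi n x) -> isbd X n x)].

Arguments quasi_iso : clear implicits.

Definition group_cplx C (K : MonData C) (A : zmodType) (act : mT K -> A -> A)
    (h : forall T, Str C T -> (T -> A) -> Prop) : cplx :=
  {| ctyp := fun n => powT (mT K) n -> A;
     cmem := fun n f => cochain K h n f;
     czero := fun n _ => 0;
     cadd := fun n f g x => f x + g x;
     copp := fun n f x => - f x;
     cd := fun n f => cdiff act f |}.

Section Double.
Variables (C : TopCat) (D G : MonData C) (A : zmodType).
Variables (act : mT (prodMon D G) -> A -> A) (h : forall T, Str C T -> (T -> A) -> Prop).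

Definition actG (g : mT G) (a : A) : A := act (mone D, g) a.
Definition actD (d : mT D) (a : A) : A := act (d, mone G) a.

Definition bicochain (p q : nat) (F : powT (mT D) p -> powT (mT G) q -> A) :=
  (forall y, cochain G h q (F y)) /\
  forall y, (exists i, (i < p)%N /\ pget (mone D) p y i = mone D) ->
     forall x, F y x = 0.

Definition vdiff p q (F : powT (mT D) p -> powT (mT G) q -> A)
  : powT (mT D) p -> powT (mT G) q.+1 -> A :=
  fun y => cdiff actG (F y).

Definition hdiff p q (F : powT (mT D) p -> powT (mT G) q -> A)
  : powT (mT D) p.+1 -> powT (mT G) q -> A :=
  fun y x => cdiff actD (fun y' => F y' x) y.

Definition totT (n : nat) := forall p q, powT (mT D) p -> powT (mT G) q -> A.

Definition totdiff (n : nat) (c : totT n) : totT n.+1 :=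
  fun p q =>
    fun y x =>
      (match q return powT (mT G) q -> A with
       | 0 => fun _ => 0
       | q'.+1 => fun x => vdiff (c p q') y x
       end x)
      + sgn q (match p return powT (mT D) p -> A with
               | 0 => fun _ => 0
               | p'.+1 => fun y => hdiff (c p' q) y x
               end y).

Definition tot_cplx : cplx :=
  {| ctyp := totT;
     cmem := fun n c => (forall p q, (p + q)%N = n -> bicochain (c p q)) /\
                        (forall p q, (p + q)%N <> n -> forall y x, c p q y x = 0);
     czero := fun n _ _ _ _ => 0;
     cadd := fun n c c' p q y x => c p q y x + c' p q y x;
     copp := fun n c p q y x => - c p q y x;
     cd := totdiff |}.
End Double.

(* Main.v *)
From Pilot Require Import Defs.
From mathcomp Require Import all_boot all_algebra.
From Stdlib Require Import FunctionalExtensionality.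
From Stdlib Require List.
(* Again, because [hom] of [vector] shadows [Defs.hom]. *)
Import Pilot.Defs.
Set Implicit Arguments. Unset Strict Implicit. Unset Printing Implicit Defensive.
Import GRing.Theory.
Local Open Scope ring_scope.

(** Write K = D x G.  Both complexes are Hom_K(-, A) of a free resolution of Z
over Z[K]: the bar complex of K on one side, the tensor product of the bar
complexes of D and G on the other.  Each resolution has an explicit, not
K-linear, contraction, so the comparison theorem produces K-linear chain maps
in both directions and homotopies by recursion on the degree: on a generator e,
phi(e) = s(phi(d e)).  Every formula involved is a signed sum of maps built from
the multiplications and projections, so the dual operators on A-valued functions
preserve h_A, and they preserve normalised functions because d and s do.
Pliancy of D makes a map from D^p to h_A(G^q) an element of h_A(D^p x G^q). *)

(** * The bar differential *)

Lemma fext2 (T U V : Type) (f g : T -> U -> V) :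
  (forall x y, f x y = g x y) -> f = g.
Proof.
by move=> fg; do 2 (apply: functional_extensionality => ?); apply: fg.
Qed.

Lemma sgnB (A : zmodType) n (a b : A) : sgn n (a - b) = sgn n a - sgn n b.
Proof. by rewrite /sgn; case: odd; rewrite // opprD. Qed.

Lemma sgnS (A : zmodType) n (a : A) : sgn n.+1 a = - sgn n a.
Proof. by rewrite /sgn /=; case: odd; rewrite ?opprK. Qed.

Lemma sgn0 (A : zmodType) n : sgn n (0 : A) = 0.
Proof. by rewrite /sgn; case: odd; rewrite ?oppr0. Qed.

Lemma subadd0 (A : zmodType) (r : A -> A) :
  (forall a b, r (a - b) = r a - r b) -> r 0 = 0.
Proof. by move=> rB; have := rB 0 0; rewrite !subrr. Qed.

Lemma subaddD (A : zmodType) (r : A -> A) :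
  (forall a b, r (a - b) = r a - r b) -> forall a b, r (a + b) = r a + r b.
Proof.
move=> rB a b; have rN c : r (- c) = - r c by rewrite -sub0r rB (subadd0 rB) sub0r.
by rewrite -[in LHS](opprK b) rB rN opprK.
Qed.

Section BarDifferential.
Variables (T : Type) (mul : T -> T -> T) (one : T) (A : zmodType).
Hypothesis mulA : forall x y z, mul x (mul y z) = mul (mul x y) z.
Hypothesis mul1 : forall x, mul one x = x.
Hypothesis mulr1 : forall x, mul x one = x.

(* [F k x] is the value of F on the chain k[x_1|...|x_n]; [a] is its value on
   the augmentation.  The recursion is d(k[x_1|x]) = k x_1[x] - k|d(x_1[x]). *)
Fixpoint bda (F : T -> seq T -> A) (a : A) (k : T) (x : seq T) : A :=
  match x with
  | [::] => a
  | x1 :: x' => F (mul k x1) x' - bda (fun b w => F k (b :: w)) (F k [::]) x1 x'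
  end.

Lemma bda_cons F a k x1 x : bda F a k (x1 :: x) =
  F (mul k x1) x - bda (fun b w => F k (b :: w)) (F k [::]) x1 x.
Proof. by []. Qed.

Lemma bda_sub F F' a a' k x :
  bda (fun k x => F k x - F' k x) (a - a') k x = bda F a k x - bda F' a' k x.
Proof.
elim: x F F' a a' k => [|x1 x IH] F F' a a' k //=.
by rewrite IH !opprD !opprK addrACA.
Qed.

Lemma bda_add F F' a a' k x :
  bda (fun k x => F k x + F' k x) (a + a') k x = bda F a k x + bda F' a' k x.
Proof.
by elim: x F F' a a' k => [|x1 x IH] F F' a a' k //=; rewrite IH opprD addrACA.
Qed.

Lemma bda_add0 F F' k x :
  bda (fun k x => F k x + F' k x) 0 k x = bda F 0 k x + bda F' 0 k x.
Proof. by rewrite -bda_add addr0. Qed.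

Lemma bda0 k x : bda (fun _ _ => 0) 0 k x = 0.
Proof. by elim: x k => [|x1 x IH] k //=; rewrite IH subr0. Qed.

Lemma bda_nat (r : A -> A) F a k x : (forall a b, r (a - b) = r a - r b) ->
  bda (fun k x => r (F k x)) (r a) k x = r (bda F a k x).
Proof.
by move=> rB; elim: x F a k => [|x1 x IH] F a k //=; rewrite IH rB.
Qed.

Lemma bda_loc F F' a a' k x :
  (forall k w, (size w).+1 = size x -> F k w = F' k w) -> (x = [::] -> a = a') ->
  bda F a k x = bda F' a' k x.
Proof.
elim: x F F' a a' k => [|x1 x IH] F F' a a' k /= FF' aa'; first exact: aa'.
rewrite FF' //; congr (_ - _); apply: IH => [b w sw | x0]; apply: FF' => //=.
- by rewrite sw.
- by rewrite x0.
Qed.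

Lemma bda_mull F a j k x : bda (fun k => F (mul j k)) a k x = bda F a (mul j k) x.
Proof. by case: x => [|x1 x] //=; rewrite mulA. Qed.

(** By induction on the word: expanding the inner differential splits the tail into a translated
    differential, which cancels the first face by [bda_mull], and a double differential of the
    shifted function, zero by induction. *)
Lemma bdaK F a k x : bda (bda F a) 0 k x = 0.
Proof.
elim: x F a k => [|x1 x IH] F a k //=.
rewrite -{2}(subr0 a) bda_sub IH subr0.
by rewrite (bda_mull F a k x1 x) subrr.
Qed.

(** The first term unfolds to [F k x] minus a differential that differs from the second term only in
    its augmentation value, so a correction survives only for empty [x]. The underlying contraction
    sends [k[x]] to [1[k|x]]. *)
Lemma bda_cone F k x :
  bda F 0 one (k :: x) + bda (fun b w => F one (b :: w)) 0 k x =
  F k x - (if x is [::] then F one [::] else 0).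
Proof.
case: x => [|x1 x] /=; first by rewrite mul1 addr0.
by rewrite mul1 subrK subr0.
Qed.

(** If the entry 1 comes first, the first two faces cancel and all others still contain it; if it
    comes later, the first face vanishes and the recursion handles the rest. *)
Lemma bda_norm F a k x : (forall k x, List.In one x -> F k x = 0) ->
  List.In one x -> bda F a k x = 0.
Proof.
elim: x F a k => [|x1 x IH] F a k //= NF [->|x1x].
- case: x {IH} => [|x2 x] /=; first by rewrite mulr1 subrr.
  rewrite mulr1 mul1 opprD addrA subrr sub0r opprK.
  have -> : (fun b w => F k [:: one, b & w]) = (fun _ _ => 0).
    by apply: fext2 => b w; apply: NF; left.
  by rewrite NF /= ?bda0 //; left.
- rewrite NF // sub0r IH ?oppr0 // => b w iw; apply: NF; by right.
Qed.

(** Written exactly as the inner faces of [cdiff], so that the two sums match term by term in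
    [cdiff_bda]. *)
Definition merge_at (y : nat -> T) i j :=
  if (j < i.-1)%N then y j else if j == i.-1 then mul (y i.-1) (y i) else y j.+1.

Lemma mkseq_cons (U : Type) (y : nat -> U) n : mkseq y n.+1 = y 0 :: mkseq (fun j => y j.+1) n.
Proof. by rewrite /mkseq /= -[1%N]addn0 iotaDl -map_comp. Qed.

(** The head of the recursive call is the face multiplying the first two entries; the remaining
    faces shift by one index and change sign. *)
Lemma bda_mkseq F a k y n :
  bda F a k (mkseq y n.+1) = F (mul k (y 0)) (mkseq (fun j => y j.+1) n)
   + \sum_(1 <= i < n.+1) sgn i (F k (mkseq (merge_at y i) n))
   + sgn n.+1 (F k (mkseq y n)).
Proof.
elim: n F a k y => [|n IH] F a k y; first by rewrite big_geq //= addr0.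
rewrite mkseq_cons bda_cons IH [in RHS]big_nat_recl // !opprD !addrA.
congr (_ + _ + _ + _).
- by rewrite /sgn /= mkseq_cons.
- rewrite -sumrN; apply: eq_big_nat => i /andP[i0 _].
  by rewrite -sgnS mkseq_cons; case: i i0.
- by rewrite -sgnS mkseq_cons.
Qed.

End BarDifferential.

(** The operators act on separate variables, so induction on [x] and additivity suffice. The
    augmentation values are arbitrary because the recursion replaces them by values of [F] and
    [b]. *)
Lemma bda_comm (T U : Type) (mT : T -> T -> T) (mU : U -> U -> U) (A : zmodType)
    (F : T -> seq T -> U -> seq U -> A) a b c k x u v :
  bda mT (fun k x => bda mU (F k x) (b k x) u v) (bda mU a c u v) k x =
  bda mU (fun u v => bda mT (fun k x => F k x u v) (a u v) k x) (bda mT b c k x) u v.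
Proof.
elim: x F a b c k => [|x1 x IH] F a b c k //=.
by rewrite (IH (fun b w => F k (b :: w)) (F k [::]) (fun b' w => b k (b' :: w)) (b k [::]))
  bda_sub.
Qed.

(** * Comparison of resolutions *)

Section Comparison.
Variables (C : TopCat) (K : MonData C) (A : zmodType).
Variables (act : mT K -> A -> A) (h : forall T, Str C T -> (T -> A) -> Prop).
Hypothesis monK : is_monoid_obj K.
Hypothesis modA : rigid_module act h.

Let mulA : forall x y z, mmul K x (mmul K y z) = mmul K (mmul K x y) z.
Proof. by case: monK. Qed.
Let mulr1 : forall x, mmul K x (mone K) = x. Proof. by case: monK. Qed.

(* A free Z[K]-complex with basis [gen]; it is seen through the functions
   [K -> gen -> A], i.e. the A-valued functions on its Z-basis.  [rd] is dual to
   the differential, [rs] to a contraction that is not K-linear, [pts] are the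
   admissible families of generators parametrised by an object of C. *)
Record resol := Resol {
  gen : Type;
  deg : gen -> nat;
  gen0 : gen;
  pts : forall Y, Str C Y -> (Y -> gen) -> Prop;
  degen : gen -> Prop;
  rd : (mT K -> gen -> A) -> (mT K -> gen -> A);
  rs : (mT K -> gen -> A) -> (mT K -> gen -> A) }.

Definition fn (X : resol) := mT K -> gen X -> A.

Definition translate (X : resol) (j : mT K) (F : fn X) : fn X := fun k e => F (mmul K j k) e.
Definition fsub (X : resol) (F F' : fn X) : fn X := fun k e => F k e - F' k e.
Definition fnul (X : resol) : fn X := fun _ _ => 0.
Definition agree (X : resol) n (F F' : fn X) := forall k e, deg e = n -> F k e = F' k e.
Definition normed (X : resol) (F : fn X) := forall k e, degen e -> F k e = 0.
Definition contF (X : resol) Y (s : Str C Y) (F : Y -> fn X) :=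
  forall k e, hom C s (mS K) k -> pts s e -> h s (fun y => F y (k y) (e y)).
Definition aug (X : resol) (F : fn X) : fn X :=
  fun k e => if deg e == 0%N then F (mone K) e else 0.

Arguments fnul : clear implicits.

(** These properties abstract signed sums of pullbacks. [op_nat], applied to the action of an
    element of [K], yields preservation of equivariance; [op_cont] lets [F] vary with the point
    because [equiv_ext] translates by a variable element. *)
Record opok (X Z : resol) (T : fn X -> fn Z) : Prop := OpOk {
  op_sub : forall F F', T (fsub F F') = fsub (T F) (T F');
  op_nat : forall r : A -> A, (forall a b, r (a - b) = r a - r b) ->
    forall F, T (fun k e => r (F k e)) = (fun k e => r (T F k e));
  op_norm : forall F, normed F -> normed (T F);
  op_cont : forall Y (s : Str C Y) (F : Y -> fn X), contF s F -> contF s (fun y => T (F y)) }.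

Record resol_ok (X : resol) : Prop := ResolOk {
  deg_gen0 : deg (gen0 X) = 0%N;
  deg_eq0 : forall e : gen X, deg e = 0%N -> e = gen0 X;
  pts_gen0 : forall Y (s : Str C Y), pts s (fun _ => gen0 X);
  pts_deg : forall Y (s : Str C Y) (e : Y -> gen X), pts s e -> exists n, forall y, deg (e y) = n;
  degen_deg : forall e : gen X, degen e -> deg e <> 0%N;
  rd_ok : opok (X := X) (Z := X) (@rd X);
  rs_ok : opok (X := X) (Z := X) (@rs X);
  rd_loc : forall n (F F' : fn X), agree n F F' -> agree n.+1 (rd F) (rd F');
  rd_deg0 : forall (F : fn X), agree 0 (rd F) (fnul X);
  rd_translate : forall j (F : fn X), rd (translate j F) = translate j (rd F);
  rd_const : forall a, agree (X := X) 1 (rd (fun _ _ => a)) (fnul X);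
  rdK : forall F : fn X, rd (rd F) = fnul X;
  rs_loc : forall n (F F' : fn X), agree n.+1 F F' -> agree n (rs F) (rs F');
  rdrs : forall F : fn X, rs (rd F) = fsub (fsub F (aug F)) (rd (rs F)) }.

Lemma fsub0 X (F : fn X) : fsub F (fnul X) = F.
Proof. by apply: fext2 => k e; rewrite /fsub subr0. Qed.

Lemma fsubxx X (F : fn X) : fsub F F = fnul X.
Proof. by apply: fext2 => k e; rewrite /fsub subrr. Qed.

Lemma op0 X Z (T : fn X -> fn Z) : opok T -> T (fnul X) = fnul Z.
Proof. by move=> To; rewrite -{1}(fsubxx (fnul X)) (op_sub To) fsubxx. Qed.

Lemma translateM X j k (F : fn X) : translate k (translate j F) = translate (mmul K j k) F.
Proof. by apply: fext2 => i e; rewrite /translate mulA. Qed.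

Lemma opok_comp X Y Z (T : fn X -> fn Y) (S : fn Y -> fn Z) :
  opok T -> opok S -> opok (fun F => S (T F)).
Proof.
move=> To So; split.
- by move=> F F'; rewrite (op_sub To) (op_sub So).
- by move=> r rB F; rewrite (op_nat To) // (op_nat So).
- by move=> F NF; apply/(op_norm So)/(op_norm To).
- by move=> Y' s F cF; apply: (op_cont So (F := fun y => T (F y))); apply: (op_cont To).
Qed.

Lemma h_sub T (s : Str C T) f g : h s f -> h s g -> h s (fun x => f x - g x).
Proof. by case: modA => _ [hs _]; case: (hs T s) => _; apply. Qed.

Lemma h_zero T (s : Str C T) : h s (fun _ => 0).
Proof. by case: modA => _ [hs _]; case: (hs T s). Qed.

Lemma h_comp T U (s : Str C T) (t : Str C U) f (g : U -> A) :
  hom C s t f -> h t g -> h s (fun x => g (f x)).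
Proof. by case: modA => _ [_ [hc _]]; apply: hc. Qed.

Lemma opok_sub X Z (T S : fn X -> fn Z) :
  opok T -> opok S -> opok (fun F => fsub (T F) (S F)).
Proof.
move=> To So; split.
- move=> F F'; rewrite (op_sub To) (op_sub So); apply: fext2 => k e.
  by rewrite /fsub !opprD addrACA.
- by move=> r rB F; rewrite (op_nat To) // (op_nat So) //; apply: fext2 => k e; rewrite /fsub rB.
- by move=> F NF k e de; rewrite /fsub (op_norm To) // (op_norm So) // subrr.
- by move=> Y' s F cF k e hk he; apply: h_sub; [apply: (op_cont To)|apply: (op_cont So)].
Qed.

Lemma opok_zero X Z : opok (fun _ : fn X => fnul Z).
Proof.
split => //.
- by move=> F F'; rewrite fsubxx.
- by move=> r rB F; apply: fext2 => k e; rewrite /fnul (subadd0 rB).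
- by move=> Y s F _ k e _ _; apply: h_zero.
Qed.

(* The K-linear map with the same values as T on the generators. *)
Definition equiv_ext (X Z : resol) (T : fn X -> fn Z) : fn X -> fn Z :=
  fun F k e => T (translate k F) (mone K) e.

Lemma hom_mul Y (s : Str C Y) k k' :
  hom C s (mS K) k -> hom C s (mS K) k' -> hom C s (mS K) (fun y => mmul K (k y) (k' y)).
Proof.
case: monK => _ _ _ hm _ hk hk'.
by have := hom_comp _ _ _ _ _ _ _ _ _ (hom_pair _ _ _ _ _ _ _ _ _ hk hk') hm.
Qed.

Lemma hom_one Y (s : Str C Y) : hom C s (mS K) (fun _ => mone K).
Proof.
case: monK => _ _ _ _ h1.
by have := hom_comp _ _ _ _ _ _ _ _ _ (hom_tt C Y s) h1.
Qed.

Lemma opok_equiv X Z (T : fn X -> fn Z) : opok T -> opok (equiv_ext T).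
Proof.
move=> To; split.
- move=> F F'; apply: fext2 => k e; rewrite /equiv_ext.
  by rewrite -[translate k _]/(fsub (translate k F) (translate k F')) (op_sub To).
- by move=> r rB F; apply: fext2 => k e; rewrite /equiv_ext (op_nat To rB (translate k F)).
- by move=> F NF k e de; apply: (op_norm To) => // k' e' de'; apply: NF.
- move=> Y s F cF k e hk he; rewrite /equiv_ext.
  apply: (op_cont To (F := fun y => translate (k y) (F y)) _ (hom_one s) he) => k' e' hk' he'.
  by apply: cF => //; apply: hom_mul.
Qed.

Lemma equiv_ext_translate X Z (T : fn X -> fn Z) j F :
  equiv_ext T (translate j F) = translate j (equiv_ext T F).
Proof. by apply: fext2 => k e; rewrite /equiv_ext translateM. Qed.

Lemma rs_aug X (F : fn X) : resol_ok X -> rs (aug F) = fnul X.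
Proof.
move=> Xo; apply: fext2 => k e.
have -> : fnul X k e = rs (fnul X) k e by rewrite (op0 (rs_ok Xo)).
by apply: (rs_loc Xo (n := deg e)) => // k' e' de'; rewrite /aug de'.
Qed.

(** Dual to a chain map from [Z] to [X]. Each [T n] acts on functions of all degrees but matters
    only in degree [n], hence the uses of [agree]. *)
Record chain_map (X Z : resol) (T : nat -> fn X -> fn Z) : Prop := ChainMap {
  cm_ok : forall n, opok (T n);
  cm_translate : forall n j F, T n (translate j F) = translate j (T n F);
  cm_loc : forall n F F', agree n F F' -> agree n (T n F) (T n F');
  cm_d : forall n F, agree n.+1 (rd (T n F)) (T n.+1 (rd F));
  cm_0 : forall F, agree 0 (T 0%N F) (fun k _ => F k (gen0 X)) }.

Lemma cm_aug X Z (T : nat -> fn X -> fn Z) n F :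
  chain_map T -> agree n.+1 (T n.+1 (aug F)) (fnul Z).
Proof.
move=> Tc k e de; rewrite -(op0 (cm_ok Tc n.+1)).
by apply: (cm_loc Tc) de => k' e' de'; rewrite /aug de'.
Qed.

Lemma chain_map_id X : resol_ok X -> chain_map (fun n (F : fn X) => F).
Proof. by move=> Xo; split=> // F k e de; rewrite (deg_eq0 Xo de). Qed.

Lemma chain_map_comp X Y Z (T : nat -> fn X -> fn Y) (S : nat -> fn Y -> fn Z) :
  resol_ok Y -> chain_map T -> chain_map S -> chain_map (fun n F => S n (T n F)).
Proof.
move=> Yo Tc Sc; split.
- by move=> n; apply: opok_comp; [apply: cm_ok Tc n|apply: cm_ok Sc n].
- by move=> n j F; rewrite (cm_translate Tc) (cm_translate Sc).
- by move=> n F F' FF'; apply/(cm_loc Sc)/(cm_loc Tc).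
- move=> n F k e de; rewrite (cm_d Sc) //.
  by apply: (cm_loc Sc) => //; apply: (cm_d Tc).
- by move=> F k e de; rewrite (cm_0 Sc) // (cm_0 Tc) // (deg_gen0 Yo).
Qed.

(** * Existence of comparison maps and their uniqueness up to homotopy *)

Section Pair.
Variables X Z : resol.
Hypotheses (Xo : resol_ok X) (Zo : resol_ok Z).

Definition cmp0 (F : fn X) : fn Z := fun k e => if deg e == 0%N then F k (gen0 X) else 0.

(** Dual form of [phi(e) = s(phi(d e))]: pullback reverses the order, so the contraction of [X] is
    applied first and the differential of [Z] last. *)
Fixpoint cmp (n : nat) : fn X -> fn Z :=
  match n with
  | 0 => cmp0
  | m.+1 => equiv_ext (fun F => rd (cmp m (rs F)))
  end.

Lemma opok_cmp0 : opok cmp0.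
Proof.
split.
- by move=> F F'; apply: fext2 => k e; rewrite /cmp0 /fsub; case: ifP => _ //; rewrite subrr.
- by move=> r rB F; apply: fext2 => k e; rewrite /cmp0; case: ifP => _ //; rewrite (subadd0 rB).
- by move=> F NF k e /(degen_deg Zo) /eqP de; rewrite /cmp0 (negPf de).
- move=> Y s F cF k e hk he; rewrite /cmp0; have [n de] := pts_deg Zo he.
  (* An admissible family has constant degree, so the test on the degree does not depend on the
     point. *)
  have -> : (fun y => if deg (e y) == 0%N then F y (k y) (gen0 X) else 0) =
            (fun y => if n == 0%N then F y (k y) (gen0 X) else 0).
    by apply: functional_extensionality => y; rewrite de.
  case: (n == 0%N); last exact: h_zero.
  by apply: (cF k (fun _ => gen0 X)) => //; exact: (pts_gen0 Xo).
Qed.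

Lemma opok_cmp n : opok (cmp n).
Proof.
elim: n => [|n IH]; first exact: opok_cmp0.
apply: opok_equiv; apply: opok_comp (rd_ok Zo).
by apply: opok_comp IH; apply: rs_ok Xo.
Qed.

Lemma cmp_translate n j F : cmp n (translate j F) = translate j (cmp n F).
Proof. by case: n => [|n] //=; rewrite equiv_ext_translate. Qed.

Lemma cmp_loc n F F' : agree n F F' -> agree n (cmp n F) (cmp n F').
Proof.
elim: n F F' => [|n IH] F F' FF' k e de /=.
  by rewrite /cmp0 FF' // (deg_gen0 Xo).
apply: (rd_loc Zo (n := n)) => //; apply/IH/(rs_loc Xo) => k' e' de'.
exact: FF'.
Qed.

Lemma cmpS n F k e : cmp n.+1 F k e = rd (cmp n (rs (translate k F))) (mone K) e.
Proof. by []. Qed.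

(** After translation to coefficient 1, [rs (rd G)] is expanded by [rdrs]: the term [G] gives the
    claim, and the contributions of [aug G] and of [rd (rs G)] have to vanish. *)
Lemma cmp_d n F : agree n.+1 (rd (cmp n F)) (cmp n.+1 (rd F)).
Proof.
elim: n F => [|n IH] F k e de; rewrite cmpS -(rd_translate Xo) (rdrs Xo);
  rewrite -[in LHS](mulr1 k) -[LHS]/(translate k (rd (cmp _ F)) (mone K) e);
  rewrite -(rd_translate Zo) -cmp_translate; move: (translate k F) => {k F} G;
  rewrite !(op_sub (opok_cmp _)) !(op_sub (rd_ok Zo)) /fsub -[LHS]subr0 -[LHS]subr0;
  congr (_ - _ - _); apply/esym.
(* In degree 0 the image of [aug G] is the constant [G (mone K) (gen0 X)]. *)
- rewrite -[RHS](rd_const Zo (G (mone K) (gen0 X)) (mone K) de).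
  apply: (rd_loc Zo) de => k e' de'; rewrite /= /cmp0 de' /=.
  by rewrite /aug (deg_gen0 Xo).
- have <- : rd (fnul Z) (mone K) e = 0 by rewrite (op0 (rd_ok Zo)).
  apply: (rd_loc Zo) de => k e' de'; rewrite /= /cmp0 de' /=.
  by rewrite (rd_deg0 Xo) // (deg_gen0 Xo).
- have <- : rd (fnul Z) (mone K) e = 0 by rewrite (op0 (rd_ok Zo)).
  congr (rd _ _ _); apply: fext2 => k e' /=; rewrite /equiv_ext.
  rewrite -[translate k (aug G)]/(aug G) (rs_aug _ Xo).
  by rewrite (op0 (opok_cmp n)) (op0 (rd_ok Zo)).
(* The induction hypothesis, applied to [rs G], makes this term a double differential. *)
- have <- : rd (rd (cmp n (rs G))) (mone K) e = 0 by rewrite (rdK Zo).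
  by apply: (rd_loc Zo) de => k e' de'; rewrite IH.
Qed.

Lemma chain_map_cmp : chain_map cmp.
Proof.
split; [exact: opok_cmp|exact: cmp_translate|exact: cmp_loc|exact: cmp_d|].
by move=> F k e de; rewrite /= /cmp0 de.
Qed.

Variables f g : nat -> fn X -> fn Z.
Hypotheses (fc : chain_map f) (gc : chain_map g).

(** Dual to the recursion [eta(e) = s(f(e) - g(e) - eta(d e))]; it starts at 0 because [f] and [g]
    agree in degree 0 by [cm_0]. *)
Fixpoint htp (n : nat) : fn X -> fn Z :=
  match n with
  | 0 => fun _ => fnul Z
  | m.+1 => equiv_ext (fun F =>
      fsub (fsub (f m.+1 (rs F)) (g m.+1 (rs F))) (rd (htp m (rs F))))
  end.

Lemma opok_htp n : opok (htp n).
Proof.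
elim: n => [|n IH]; first exact: opok_zero.
apply/opok_equiv/opok_sub; first apply: opok_sub.
- by apply: opok_comp (cm_ok fc _); apply: rs_ok Xo.
- by apply: opok_comp (cm_ok gc _); apply: rs_ok Xo.
- by apply: opok_comp (rd_ok Zo); apply: opok_comp IH; apply: rs_ok Xo.
Qed.

Lemma htp_translate n j F : htp n (translate j F) = translate j (htp n F).
Proof. by case: n => [|n] //=; rewrite equiv_ext_translate. Qed.

Lemma htp_loc n F F' : agree n.+1 F F' -> agree n (htp n F) (htp n F').
Proof.
elim: n F F' => [|n IH] F F' FF' k e de //=.
have sFF' : agree n.+1 (rs (translate k F)) (rs (translate k F')).
  by apply: (rs_loc Xo) => k' e' de'; apply: FF'.
rewrite /equiv_ext /fsub (cm_loc fc sFF') // (cm_loc gc sFF') //; congr (_ - _).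
by apply: (rd_loc Zo) de; apply: IH.
Qed.

Lemma htp_d0 F : agree 0 (f 0%N F) (g 0%N F).
Proof. by move=> k e de; rewrite (cm_0 fc) // (cm_0 gc). Qed.

Lemma htpS n F k e : htp n.+1 F k e =
  f n.+1 (rs (translate k F)) (mone K) e - g n.+1 (rs (translate k F)) (mone K) e
  - rd (htp n (rs (translate k F))) (mone K) e.
Proof. by []. Qed.

Lemma htp_aug n F : htp n (aug F) = fnul Z.
Proof.
case: n => [|n] //; apply: fext2 => k e.
rewrite htpS -[translate k (aug F)]/(aug F) (rs_aug _ Xo) (op0 (cm_ok fc _)) (op0 (cm_ok gc _)).
by rewrite (op0 (opok_htp n)) (op0 (rd_ok Zo)) /fnul !subr0.
Qed.

(** The second hypothesis is the homotopy relation in degree [n] after applying [rd], which has the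
    same form for [n = 0] and [n > 0]. It cancels the contributions of [rd (rs G)] that [rdrs]
    produces. *)
Lemma htp_step n F k e : deg e = n.+1 ->
  (forall H, rd (htp n (rd H)) (mone K) e = rd (f n H) (mone K) e - rd (g n H) (mone K) e) ->
  htp n.+1 (rd F) k e = fsub (fsub (f n.+1 F) (g n.+1 F)) (rd (htp n F)) k e.
Proof.
move=> de key; rewrite htpS -(rd_translate Xo) (rdrs Xo).
rewrite -[in RHS](mulr1 k) -[RHS]/(fsub (fsub (translate k (f n.+1 F)) (translate k (g n.+1 F)))
  (translate k (rd (htp n F))) (mone K) e).
rewrite -(rd_translate Zo) -(cm_translate fc) -(cm_translate gc) -htp_translate.
move: (translate k F) => {k F} G.
rewrite !(op_sub (cm_ok fc _)) !(op_sub (cm_ok gc _)) !(op_sub (opok_htp n)) !(op_sub (rd_ok Zo)).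
rewrite htp_aug (op0 (rd_ok Zo)) /fsub (cm_aug _ fc) // (cm_aug _ gc) // key.
rewrite -(cm_d fc) // -(cm_d gc) // /fnul !subr0.
set a := f _ _ _ _; set b := g _ _ _ _; set c := rd (f _ _) _ _; set d := rd (g _ _) _ _.
by rewrite (opprD b) addrACA -opprD opprB addrA subrK.
Qed.

Lemma htp_d n F : agree n.+1 (htp n.+1 (rd F))
  (fsub (fsub (f n.+1 F) (g n.+1 F)) (rd (htp n F))).
Proof.
elim: n F => [|n IH] F k e de.
  have key H : rd (htp 0 (rd H)) (mone K) e = rd (f 0%N H) (mone K) e - rd (g 0%N H) (mone K) e.
    rewrite (op0 (rd_ok Zo)) (rd_loc Zo (n := 0%N) (F' := g 0%N H)) ?subrr //.
    exact: htp_d0.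
  exact: htp_step.
have key H : rd (htp n.+1 (rd H)) (mone K) e = rd (f n.+1 H) (mone K) e - rd (g n.+1 H) (mone K) e.
  rewrite (rd_loc Zo (IH H)) //.
  by rewrite !(op_sub (rd_ok Zo)) (rdK Zo) fsub0.
exact: htp_step.
Qed.
End Pair.

(** * Equivariant normalised functions on a resolution and the complexes they model *)

Definition fadd (X : resol) (F F' : fn X) : fn X := fun k e => F k e + F' k e.
Definition equivar (X : resol) (F : fn X) := forall j k e, F (mmul K j k) e = act j (F k e).
Definition member (X : resol) (F : fn X) :=
  [/\ equivar F, normed F & forall Y (s : Str C Y), contF s (fun _ => F)].

(** Identifies degree [n] of [cx] with members restricted to generators of degree [n]. Functions
    live in all degrees, so [unliftK] is only an agreement in degree [n]. *)
Record model (X : resol) (cx : cplx) := Model {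
  lift : forall n, ctyp cx n -> fn X;
  unlift : forall n, fn X -> ctyp cx n;
  member_lift : forall n x, cmem cx n x -> member (lift x);
  cmem_unlift : forall n F, member F -> cmem cx n (unlift n F);
  liftK : forall n x, cmem cx n x -> unlift n (lift x) = x;
  unlift_loc : forall n F F', agree n F F' -> unlift n F = unlift n F';
  unliftK : forall n F, equivar F -> agree n (lift (unlift n F)) F;
  cd_unlift : forall n F, equivar F -> cd cx n (unlift n F) = unlift n.+1 (rd F);
  liftD : forall n x x', lift (cadd cx n x x') = fadd (lift x) (lift x');
  unliftD : forall n F F', unlift n (fadd F F') = cadd cx n (unlift n F) (unlift n F');
  unliftN : forall n F, unlift n (fsub (fnul X) F) = copp cx n (unlift n F);
  unlift0 : forall n, unlift n (fnul X) = czero cx n }.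

Lemma actB j a b : act j (a - b) = act j a - act j b.
Proof.
case: modA => [[actD _] _].
have -> : act j a = act j (a - b) + act j b by rewrite -actD subrK.
by rewrite addrK.
Qed.

Lemma act0 j : act j 0 = 0.
Proof. exact: subadd0 (actB j). Qed.

Lemma fadd_fsub X (F F' : fn X) : fadd F F' = fsub F (fsub (fnul X) F').
Proof. by apply: fext2 => k e; rewrite /fadd /fsub /fnul sub0r opprK. Qed.

Lemma op_add X Z (T : fn X -> fn Z) F F' : opok T -> T (fadd F F') = fadd (T F) (T F').
Proof. by move=> To; rewrite !fadd_fsub !(op_sub To) (op0 To). Qed.

Lemma member0 X : member (fnul X).
Proof.
split=> //; first by move=> j k e; rewrite /fnul act0.
by move=> Y s k e _ _; apply: h_zero.
Qed.

Lemma member_sub X (F F' : fn X) : member F -> member F' -> member (fsub F F').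
Proof.
move=> [eF nF cF] [eF' nF' cF']; split.
- by move=> j k e; rewrite /fsub eF eF' actB.
- by move=> k e de; rewrite /fsub nF // nF' // subrr.
- by move=> Y s k e hk he; apply: h_sub; [apply: cF|apply: cF'].
Qed.

(** For equivariant [F], translation by [j] is the same as applying [act j] to the values, so
    [op_nat] gives the equivariance of [T F]. *)
Lemma member_op X Z (T : fn X -> fn Z) F : opok T ->
  (forall j F, T (translate j F) = translate j (T F)) -> member F -> member (T F).
Proof.
move=> To Te [eF nF cF]; split.
- move=> j k e; rewrite -[LHS]/(translate j (T F) k e) -Te.
  have -> : translate j F = (fun k e => act j (F k e)) by apply: fext2 => k' e'; apply: eF.
  by rewrite (op_nat To (actB j)).
- exact: op_norm To F nF.
- by move=> Y s; apply: (op_cont To (F := fun _ => F)).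
Qed.

Lemma member_rd X F : resol_ok X -> member F -> member (X := X) (rd F).
Proof. by move=> Xo; apply: member_op (rd_ok Xo) (rd_translate Xo). Qed.

Lemma member_cm X Z (T : nat -> fn X -> fn Z) n F : chain_map T -> member F -> member (T n F).
Proof. by move=> Tc; apply: member_op (cm_ok Tc n) (cm_translate Tc n). Qed.

Lemma cocycle_lift X cx (m : model X cx) n x :
  resol_ok X -> cmem cx n x -> cd cx n x = czero cx n.+1 ->
  agree n.+1 (rd (lift m x)) (fnul X).
Proof.
move=> Xo mx dx0 k e de; have mF := member_lift m mx.
have [eF _ _] := mF; have [edF _ _] := member_rd Xo mF; have [e0 _ _] := member0 X.
rewrite -(unliftK m edF k de) -(cd_unlift m) // (liftK m mx) dx0.
by rewrite -(unlift0 m) (unliftK m).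
Qed.

(** Both composites of the two comparison maps are homotopic to the identity, which gives
    surjectivity and injectivity on cohomology. *)
Lemma quasi_iso_of_resolutions (X Z : resol) (cx cz : cplx) :
  resol_ok X -> resol_ok Z -> model X cx -> model Z cz ->
  exists phi, quasi_iso cx cz phi.
Proof.
move=> Xo Zo mX mZ.
pose f := @cmp X Z; pose g := @cmp Z X.
have fc : chain_map f := chain_map_cmp Xo Zo.
have gc : chain_map g := chain_map_cmp Zo Xo.
clearbody f g.
have fgc := chain_map_comp Xo gc fc.
have gfc := chain_map_comp Zo fc gc.
exists (fun n x => unlift mZ n (f n (lift mX x))).
have eqm W (F : fn W) : member F -> equivar F by case.
split.
- by move=> n x mx; apply: cmem_unlift; apply: member_cm fc _; apply: member_lift.
- by move=> n x x' mx mx'; rewrite liftD (op_add _ _ (cm_ok fc n)) unliftD.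
- move=> n x mx; have mF := member_lift mX mx.
  rewrite cd_unlift; last by apply/eqm/member_cm.
  apply: unlift_loc => k e de; rewrite (cm_d fc) //.
  apply: (cm_loc fc) de; rewrite -{1}(liftK mX mx) cd_unlift; last exact: eqm.
  by apply: unliftK; apply/eqm/member_rd.
(* Surjectivity: the class of [y] is hit by that of [g(y)], since in positive degree [y - f(g(y))]
   is the differential of the homotopy at [y]. *)
- move=> n y my dy0; have mF := member_lift mZ my; have dF := cocycle_lift mZ Zo my dy0.
  set F := lift mZ y in mF dF *.
  have mgF : member (g n F) by apply: member_cm.
  exists (unlift mX n (g n F)); split.
  + exact: cmem_unlift.
  + rewrite cd_unlift; last exact: eqm.
    rewrite -(unlift0 mX); apply: unlift_loc => k e de.
    by rewrite (cm_d gc) // -(op0 (cm_ok gc n.+1)); apply: (cm_loc gc).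
  + rewrite -unliftN -[y in cadd _ _ y](liftK mZ my) -unliftD -/F.
    rewrite (unlift_loc mZ (F' := fsub F (f n (g n F)))); last first.
      move=> k e de; rewrite /fadd /fsub /fnul sub0r; congr (_ - _).
      by apply: (cm_loc fc) de; apply: unliftK; apply: eqm.
    case: n y my dy0 @F mF dF mgF => [|n] y my dy0 F mF dF mgF /=.
      (* In degree 0 the only boundary is 0, and there the composite equals the identity. *)
      rewrite -(unlift0 mZ); apply: unlift_loc => k e de.
      by rewrite /fsub -(htp_d0 (chain_map_id Zo) fgc) // subrr.
    pose H := htp (fun n (F : fn Z) => F) (fun n F => f n (g n F)).
    have mH : member (H n F).
      apply: member_op mF; first exact: (opok_htp Zo Zo (chain_map_id Zo) fgc n).
      by move=> j F'; apply: htp_translate.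
    exists (unlift mZ n (H n F)); split; first exact: cmem_unlift.
    rewrite cd_unlift; last exact: eqm.
    apply: unlift_loc => k e de.
    have := htp_d Zo Zo (chain_map_id Zo) fgc F k de.
    rewrite (htp_loc Zo Zo (chain_map_id Zo) fgc dF) //.
    rewrite (op0 (opok_htp Zo Zo (chain_map_id Zo) fgc _)).
    by move/esym/eqP; rewrite /fsub /fnul subr_eq0 => /eqP ->.
(* Injectivity: if [f(x)] is the differential of [y], then [x] is the differential of [g(y)] plus
   the homotopy at [x]. *)
- move=> n x mx dx0; have mF := member_lift mX mx; have dF := cocycle_lift mX Xo mx dx0.
  rewrite -{2}(liftK mX mx).
  set F := lift mX x in mF dF *.
  have mfF : member (f n F) by apply: member_cm.
  case: n x mx dx0 @F mF dF mfF => [|n] x mx dx0 F mF dF mfF /=.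
    move=> fF0; rewrite -(unlift0 mX); apply: unlift_loc => k e de.
    rewrite (htp_d0 (chain_map_id Xo) gfc) // -(op0 (cm_ok gc 0)).
    apply: (cm_loc gc) de => k' e' de'.
    rewrite -(unliftK mZ _ k' de'); last exact: eqm.
    by rewrite fF0 -(unlift0 mZ) unliftK //; apply/eqm/member0.
  case=> y [my dy]; have mG := member_lift mZ my.
  set G := lift mZ y in mG.
  pose H := htp (fun n (F : fn X) => F) (fun n F => g n (f n F)).
  have mH : member (H n F).
    apply: member_op mF; first exact: (opok_htp Xo Xo (chain_map_id Xo) gfc n).
    by move=> j F'; apply: htp_translate.
  have mgG : member (g n G) by apply: member_cm.
  exists (unlift mX n (fadd (H n F) (g n G))).
  have mS : member (fadd (H n F) (g n G)).
    by rewrite fadd_fsub; apply: member_sub => //; apply: member_sub => //; apply: member0.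
  split; first exact: cmem_unlift.
  rewrite cd_unlift; last exact: eqm.
  apply: unlift_loc => k e de; rewrite (op_add _ _ (rd_ok Xo)) /fadd.
  have := htp_d Xo Xo (chain_map_id Xo) gfc F k de.
  rewrite (htp_loc Xo Xo (chain_map_id Xo) gfc dF) //.
  rewrite (op0 (opok_htp Xo Xo (chain_map_id Xo) gfc _)).
  move/esym/eqP; rewrite /fsub /fnul subr_eq0 => /eqP <-.
  rewrite (cm_d gc) // -[RHS](subrK (g n.+1 (f n.+1 F) k e)); congr (_ + _).
  apply: (cm_loc gc) de => k' e' de'.
  rewrite -(unliftK mZ (F := f n.+1 F) _ k' de'); last exact: eqm.
  rewrite -dy -(liftK mZ my) cd_unlift; last exact: eqm.
  by rewrite unliftK //; apply/eqm/member_rd.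
Qed.

End Comparison.

(** * The bar resolution *)

Section Points.
Variables (C : TopCat) (Y : Type) (s : Str C Y).

Fixpoint hom_seq (T : Type) (t : Str C T) (zs : seq (Y -> T)) : Prop :=
  if zs is z :: zs' then hom C s t z /\ hom_seq t zs' else True.

(** A constant map factors through the terminal object, which is discrete because the discrete
    functor preserves finite limits, and every map out of a discrete object is a morphism. *)
Lemma hom_const (T : Type) (t : Str C T) a : hom C s t (fun _ => a).
Proof.
apply: (hom_comp C _ _ _ s (sunit C) t (fun _ => tt) (fun _ => a)); first exact: hom_tt.
apply: (hom_comp C _ _ _ (sunit C) (sdisc C unit) t (fun x => x)); first exact: disc_tt.
exact: hom_disc.
Qed.

Lemma hom_seq_mkseq (T : Type) (t : Str C T) (z : nat -> Y -> T) n :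
  (forall i, (i < n)%N -> hom C s t (z i)) -> hom_seq t (mkseq z n).
Proof.
elim: n z => [|n IH] z hz //; rewrite mkseq_cons; split; first exact: hz.
by apply: IH => i lin; apply: hz.
Qed.

Lemma hom_nth (T : Type) (t : Str C T) a zs i :
  hom_seq t zs -> hom C s t (fun y => nth a (map (fun z => z y) zs) i).
Proof.
elim: zs i => [|z zs IH] i /=; first by move=> _; case: i => [|i] /=; apply: hom_const.
by case=> hz hzs; case: i => [|i] //=; apply: IH.
Qed.

Lemma hom_pmk (T : Type) (t : Str C T) (z : Y -> nat -> T) n :
  (forall i, hom C s t (fun y => z y i)) -> hom C s (powS t n) (fun y => pmk n (z y)).
Proof.
by move=> hz; elim: n => [|n IH] /=; [exact: hom_tt|exact: hom_pair].
Qed.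
End Points.

Lemma hom_pget (C : TopCat) (T : Type) (t : Str C T) a n i :
  hom C (powS t n) t (fun x => pget a n x i).
Proof.
elim: n => [|n IH] /=; first exact: hom_const.
case: (i == n); first exact: hom_snd.
exact: (hom_comp _ _ _ _ _ _ _ _ _ (hom_fst _ _ _ _ _) IH).
Qed.

Lemma eq_pmk (T : Type) n (y z : nat -> T) :
  (forall i, (i < n)%N -> y i = z i) -> pmk n y = pmk n z.
Proof.
elim: n => [|n IH] yz //=; rewrite (yz n) // IH // => i lin.
by apply: yz; apply: leqW.
Qed.

Lemma pget_pmk (T : Type) (a : T) n y i : (i < n)%N -> pget a n (pmk n y) i = y i.
Proof.
elim: n => [|n IH] //=; rewrite ltnS leq_eqVlt.
by case: eqP => [->|_] //=; apply: IH.
Qed.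

Lemma pgetK (T : Type) (a : T) n x : pmk n (pget a n x) = x.
Proof.
elim: n x => [|n IH] /=; first by case.
case=> x z /=; rewrite eqxx -[in RHS](IH x); congr (_, _); apply: eq_pmk => i lin.
by rewrite (ltn_eqF lin).
Qed.

Lemma mkseq_pget_pmk (T : Type) (a : T) n y : mkseq (pget a n (pmk n y)) n = mkseq y n.
Proof.
apply/(@eq_from_nth _ a); first by rewrite !size_mkseq.
by move=> i; rewrite size_mkseq => lin; rewrite !nth_mkseq // pget_pmk.
Qed.

Lemma pmk_nth_mkseq (T : Type) (a : T) n x : pmk n (nth a (mkseq (pget a n x) n)) = x.
Proof.
by rewrite -[RHS](pgetK a); apply: eq_pmk => i lin; rewrite nth_mkseq.
Qed.

Lemma In_mkseq (T : Type) (a : T) (y : nat -> T) n :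
  List.In a (mkseq y n) <-> exists i, (i < n)%N /\ y i = a.
Proof.
elim: n y => [|n IH] y; first by split=> [|[i []]].
rewrite mkseq_cons /= IH; split.
- by case=> [<-|[i [lin <-]]]; [exists 0%N|exists i.+1].
- by case=> [[|i] [lin <-]]; [left|right; exists i].
Qed.

Lemma In_nth (T : Type) (a : T) x : List.In a x -> exists i, (i < size x)%N /\ nth a x i = a.
Proof. by rewrite -{1}(mkseq_nth a x) => /In_mkseq. Qed.

Lemma map_mkseq_at (Y T : Type) (z : nat -> Y -> T) n y :
  map (fun f => f y) (mkseq z n) = mkseq (fun i => z i y) n.
Proof. by rewrite /mkseq -map_comp. Qed.

Lemma monoid_obj_prod C (M N : MonData C) :
  is_monoid_obj M -> is_monoid_obj N -> is_monoid_obj (prodMon M N).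
Proof.
move=> monM monN; have [aM lM rM _ _] := monM; have [aN lN rN _ _] := monN.
split=> /=.
- by move=> x y z; rewrite aM aN.
- by case=> x y /=; rewrite lM lN.
- by case=> x y /=; rewrite rM rN.
- have hp := fun p => hom_comp C _ _ _ _ _ _ _ _ p (hom_fst C _ _ (mS M) (mS N)).
  have hq := fun p => hom_comp C _ _ _ _ _ _ _ _ p (hom_snd C _ _ (mS M) (mS N)).
  apply: hom_pair.
    by apply: (hom_mul monM); apply: hp; [exact: hom_fst|exact: hom_snd].
  by apply: (hom_mul monN); apply: hq; [exact: hom_fst|exact: hom_snd].
- exact: hom_const.
Qed.

(** * Bar differentials over a monoid object *)

Section Bar.
Variables (C : TopCat) (M : MonData C) (A : zmodType).
Variable (h : forall T, Str C T -> (T -> A) -> Prop).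
Hypothesis monM : is_monoid_obj M.
Hypothesis hB : forall T (s : Str C T) f g, h s f -> h s g -> h s (fun x => f x - g x).

Lemma bda_cont Y (s : Str C Y) (F : Y -> mT M -> seq (mT M) -> A) a k zs :
  (forall k zs, hom C s (mS M) k -> hom_seq s (mS M) zs ->
    h s (fun y => F y (k y) (map (fun z => z y) zs))) ->
  h s a -> hom C s (mS M) k -> hom_seq s (mS M) zs ->
  h s (fun y => bda (mmul M) (F y) (a y) (k y) (map (fun z => z y) zs)).
Proof.
elim: zs F a k => [|z zs IH] F a k cF ha hk //= [hz hzs]; apply: hB.
- by apply: (cF (fun y => mmul M (k y) (z y))) => //; apply: hom_mul.
- apply: (IH (fun y b w => F y (k y) (b :: w)) (fun y => F y (k y) [::])) => //.
  + by move=> k' zs' hk' hzs'; apply: (cF k (k' :: zs')).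
  + exact: (cF k [::]).
Qed.

(** Only the first face changes the coefficient of a chain, and the hypothesis on [F] turns this
    coefficient into the action [r]; the other faces match through [bda_mkseq]. *)
Lemma cdiff_bda (r : mT M -> A -> A) (F : mT M -> seq (mT M) -> A) n x :
  (forall k e, F k e = r k (F (mone M) e)) ->
  cdiff r (fun x => F (mone M) (mkseq (pget (mone M) n x) n)) x =
  bda (mmul M) F 0 (mone M) (mkseq (pget (mone M) n.+1 x) n.+1).
Proof.
have [_ l1 _ _ _] := monM => rF; rewrite bda_mkseq /cdiff l1 !mkseq_pget_pmk -rF.
by congr (_ + _ + _); apply: eq_bigr => i _; rewrite mkseq_pget_pmk.
Qed.

Lemma cdiff0 (r : mT M -> A -> A) n x : (forall k, r k 0 = 0) ->
  cdiff (n := n) r (fun _ => 0) x = 0.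
Proof.
by move=> r0; rewrite /cdiff r0 sgn0 big1 ?addr0 // => i _; rewrite sgn0.
Qed.
End Bar.

Section BarResolution.
Variables (C : TopCat) (K : MonData C) (A : zmodType).
Variables (act : mT K -> A -> A) (h : forall T, Str C T -> (T -> A) -> Prop).
Hypothesis monK : is_monoid_obj K.
Hypothesis modA : rigid_module act h.

Definition bar_resol : resol K A := {|
  gen := seq (mT K);
  deg := size;
  gen0 := [::];
  pts := fun Y s e => exists2 zs, hom_seq s (mS K) zs & e = (fun y => map (fun z => z y) zs);
  degen := List.In (mone K);
  rd := fun F k x => bda (mmul K) F 0 k x;
  rs := fun F k x => F (mone K) (k :: x) |}.

Lemma bar_resol_ok : resol_ok h bar_resol.
Proof.
have [aK lK rK _ _] := monK.
split.
- by [].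
- by case.
- by move=> Y s; exists [::].
- by move=> Y s e [zs _ ->]; exists (size zs) => y; rewrite /= size_map.
- by case.
- split.
  + by move=> F F'; apply: fext2 => k x; rewrite /fsub /= -bda_sub subr0.
  + by move=> r rB F; apply: fext2 => k x; rewrite /= -(bda_nat _ _ _ _ _ rB) (subadd0 rB).
  + by move=> F NF k x /= kx; apply: bda_norm kx.
  + move=> Y s F cF k e hk [zs hzs ->] /=.
    apply: (bda_cont monK (h_sub modA)) => //; last exact: h_zero modA _ _.
    by move=> k' zs' hk' hzs'; apply: cF => //; exists zs'.
- split => //.
  + by move=> F NF k x /= kx; apply: NF; right.
  + move=> Y s F cF k e hk [zs hzs ->] /=.
    apply: (cF (fun _ => mone K) (fun y => k y :: map (fun z => z y) zs)).
      exact: hom_const.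
    by exists (k :: zs).
- move=> n F F' FF' k x /= sx; apply: bda_loc => [k' w|x0]; last by rewrite x0 in sx.
  by rewrite (sx : size x = _) => -[sw]; apply: FF'.
- by move=> F k [].
- by move=> j F; apply: fext2 => k x; rewrite /= /translate -bda_mull.
- by move=> a k [|x1 []] //= _; rewrite /fnul subrr.
- by move=> F; apply: fext2 => k x; apply: bdaK.
- by move=> n F F' FF' k x sx; apply: FF'; congr S.
- move=> F; apply: fext2 => k x; apply/eqP; rewrite /fsub eq_sym subr_eq eq_sym; apply/eqP.
  by rewrite (bda_cone lK) /aug; case: x.
Qed.

(** Restriction to coefficient 1 is inverse, in degree [n], to the extension by equivariance, which
    is set to zero in other degrees. *)
Definition bar_model : model act h bar_resol (group_cplx act h).
Proof.
have [aK lK rK _ _] := monK.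
have act1 a : act (mone K) a = a by case: modA => [[_ []]].
have actM k k' a : act (mmul K k k') a = act k (act k' a) by case: modA => [[_ []]].
have actD k a b : act k (a + b) = act k a + act k b by case: modA => [[? []]].
apply: (@Model _ _ _ act h bar_resol (group_cplx act h)
  (fun n f k x => if size x == n then act k (f (pmk n (nth (mone K) x))) else 0)
  (fun n F x => F (mone K) (mkseq (pget (mone K) n x) n))).
- move=> n f [hf nf]; split.
  + by move=> j k x; case: ifP => _; rewrite ?actM ?(act0 modA).
  + move=> k x dx; have [i [lix xi]] := In_nth (dx : List.In _ x); case: eqP => // sx.
    rewrite nf ?(act0 modA) //; exists i; rewrite -sx; split=> //.
    by rewrite pget_pmk.
  + move=> Y s k e hk [zs hzs ->].
    have -> : (fun y => if size (map (fun z => z y) zs) == n then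
        act (k y) (f (pmk n (nth (mone K) (map (fun z => z y) zs)))) else 0) =
      (fun y => if size zs == n then
        act (k y) (f (pmk n (nth (mone K) (map (fun z => z y) zs)))) else 0).
      by apply: functional_extensionality => y; rewrite size_map.
    case: eqP => _; last exact: h_zero modA _ _.
    (* The rigidification axiom puts [(k, x) -> k f(x)] in [h] of the product, and the family is its
       pullback along a morphism. *)
    have [_ [_ [_ [_ hact]]]] := modA.
    have hp := hom_pair _ _ _ _ _ _ _ _ _ hk
      (hom_pmk n (fun i => hom_nth (mone K) i hzs)).
    exact: (h_comp modA hp (hact _ _ _ hf)).
- move=> n F [eF nF cF]; split.
  + have := cF _ (powS (mS K) n) (fun _ => mone K) (fun x => mkseq (pget (mone K) n x) n).
    apply; first exact: hom_const.
    exists (mkseq (fun i x => pget (mone K) n x i) n).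
      by apply: hom_seq_mkseq => i _; apply: hom_pget.
    by apply: functional_extensionality => y; rewrite map_mkseq_at.
  + by move=> x hx; apply: nF; apply/In_mkseq.
- move=> n f _; apply: functional_extensionality => x.
  by rewrite size_mkseq eqxx act1 pmk_nth_mkseq.
- move=> n F F' FF'; apply: functional_extensionality => x.
  by apply: FF'; rewrite /= size_mkseq.
- move=> n F eF k x <-; rewrite eqxx mkseq_pget_pmk mkseq_nth.
  by rewrite -eF rK.
- move=> n F eF; apply: functional_extensionality => x.
  by apply: (cdiff_bda monK) => k e; rewrite -eF rK.
- move=> n f f'; apply: fext2 => k x; rewrite /fadd.
  by case: ifP => _; rewrite ?actD ?addr0.
- by [].
- by move=> n F; apply: functional_extensionality => x; rewrite /fsub /fnul sub0r.
- by [].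
Defined.
End BarResolution.

(** * The tensor product of two bar resolutions *)

Section TensorResolution.
Variables (C : TopCat) (D G : MonData C) (A : zmodType).
Variables (act : mT (prodMon D G) -> A -> A) (h : forall T, Str C T -> (T -> A) -> Prop).
Hypothesis monD : is_monoid_obj D.
Hypothesis monG : is_monoid_obj G.
Hypothesis modA : rigid_module act h.
Hypothesis pliantD : pliant D h.

(** The sign sits on the [D]-part and depends on the [G]-degree, as in [totdiff]. *)
Definition tensor_rd (F : mT D * mT G -> seq (mT D) * seq (mT G) -> A) k e : A :=
  bda (mmul G) (fun g z => F (k.1, g) (e.1, z)) 0 k.2 e.2
  + sgn (size e.2) (bda (mmul D) (fun d y => F (d, k.2) (y, e.2)) 0 k.1 e.1).

(* Dual to the contraction 1 (x) s_G + s_D (x) (unit o augmentation of G). *)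
Definition tensor_rs (F : mT D * mT G -> seq (mT D) * seq (mT G) -> A) k e : A :=
  F (k.1, mone G) (e.1, k.2 :: e.2)
  + (if e.2 is [::] then F (mone D, mone G) (k.1 :: e.1, [::]) else 0).

Definition tensor_resol : resol (prodMon D G) A :=
  @Resol C (prodMon D G) A (seq (mT D) * seq (mT G))%type
    (fun e => (size e.1 + size e.2)%N)
    ([::], [::])
    (fun Y s e => exists ys zs, [/\ hom_seq s (mS D) ys, hom_seq s (mS G) zs &
       e = (fun y => (map (fun z => z y) ys, map (fun z => z y) zs))])
    (fun e => List.In (mone D) e.1 \/ List.In (mone G) e.2)
    tensor_rd tensor_rs.

Lemma h_sgn T (s : Str C T) n (f : T -> A) : h s f -> h s (fun x => sgn n (f x)).
Proof.
move=> hf; rewrite /sgn; case: odd => //.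
have := h_sub modA (h_zero modA s) hf.
by rewrite (_ : (fun x => 0 - f x) = fun x => - f x) //;
  apply: functional_extensionality => x; rewrite sub0r.
Qed.

Lemma h_add T (s : Str C T) (f g : T -> A) : h s f -> h s g -> h s (fun x => f x + g x).
Proof.
move=> hf hg; have := h_sub modA hf (h_sub modA (h_zero modA s) hg).
by rewrite (_ : (fun x => f x - (0 - g x)) = fun x => f x + g x) //;
  apply: functional_extensionality => x; rewrite sub0r opprK.
Qed.

Lemma hom_fst_comp Y (s : Str C Y) k :
  hom C s (mS (prodMon D G)) k -> hom C s (mS D) (fun y => (k y).1).
Proof. by move=> hk; apply: (hom_comp C _ _ _ _ _ _ _ _ hk); apply: hom_fst. Qed.

Lemma hom_snd_comp Y (s : Str C Y) k :
  hom C s (mS (prodMon D G)) k -> hom C s (mS G) (fun y => (k y).2).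
Proof. by move=> hk; apply: (hom_comp C _ _ _ _ _ _ _ _ hk); apply: hom_snd. Qed.

Lemma opok_tensor_rd : opok h (X := tensor_resol) (Z := tensor_resol) tensor_rd.
Proof.
have [aD lD rD _ _] := monD; have [aG lG rG _ _] := monG.
split.
- move=> F F'; apply: fext2 => k e; rewrite /tensor_rd /fsub.
  rewrite opprD addrACA -sgnB -!bda_sub subr0; congr (_ + sgn _ _).
- move=> r rB F; apply: fext2 => k e; rewrite /tensor_rd (subaddD rB).
  have -> : r (sgn (size e.2) (bda (mmul D) (fun d y => F (d, k.2) (y, e.2)) 0 k.1 e.1)) =
    sgn (size e.2) (r (bda (mmul D) (fun d y => F (d, k.2) (y, e.2)) 0 k.1 e.1)).
    by rewrite /sgn; case: odd => //; rewrite -sub0r rB (subadd0 rB) sub0r.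
  by rewrite -!(bda_nat _ _ _ _ _ rB) (subadd0 rB).
- move=> F NF k [y z] [/= dy|/= dz]; rewrite /tensor_rd /=.
  + rewrite (bda_norm lD rD) ?sgn0 ?addr0 //; last by move=> *; apply: NF; left.
    rewrite (_ : (fun g z => _) = fun _ _ => 0) ?bda0 //.
    by apply: fext2 => g w; apply: NF; left.
  + rewrite (bda_norm lG rG) ?add0r //; last by move=> *; apply: NF; right.
    rewrite (_ : (fun d y => _) = fun _ _ => 0) ?bda0 ?sgn0 //.
    by apply: fext2 => g w; apply: NF; right.
- move=> Y s F cF k e hk [ys [zs [hys hzs ->]]]; rewrite /tensor_rd /=.
  apply: h_add.
  + apply: (bda_cont monG (h_sub modA)
      (F := fun y g z => F y ((k y).1, g) (map (fun z => z y) ys, z)) (a := fun _ => 0)) => //.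
    * move=> g zs' hg hzs'.
      apply: (cF (fun y => ((k y).1, g y))
        (fun y => (map (fun z => z y) ys, map (fun z => z y) zs'))).
        by apply: hom_pair => //; apply: hom_fst_comp.
      by exists ys, zs'.
    * exact: h_zero modA _ _.
    * exact: hom_snd_comp.
  + rewrite (_ : (fun y => _) = fun y => sgn (size zs) (bda (mmul D) (fun d w =>
      F y (d, (k y).2) (w, map (fun z => z y) zs)) 0 (k y).1 (map (fun z => z y) ys))); last first.
      by apply: functional_extensionality => y; rewrite size_map.
    apply: h_sgn; apply: (bda_cont monD (h_sub modA)
      (F := fun y d w => F y (d, (k y).2) (w, map (fun z => z y) zs)) (a := fun _ => 0)) => //.
    * move=> d ys' hd hys'.
      apply: (cF (fun y => (d y, (k y).2))
        (fun y => (map (fun z => z y) ys', map (fun z => z y) zs))).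
        by apply: hom_pair => //; apply: hom_snd_comp.
      by exists ys', zs.
    * exact: h_zero modA _ _.
    * exact: hom_fst_comp.
Qed.

Lemma opok_tensor_rs : opok h (X := tensor_resol) (Z := tensor_resol) tensor_rs.
Proof.
split.
- move=> F F'; apply: fext2 => k [y [|z1 z]]; rewrite /tensor_rs /fsub /= ?addr0 //.
  by rewrite opprD addrACA.
- move=> r rB F; apply: fext2 => k [y [|z1 z]]; rewrite /tensor_rs (subaddD rB) //=.
  by rewrite (subadd0 rB).
- move=> F NF k [y z] /= dyz; rewrite /tensor_rs /= NF ?add0r; last first.
    by case: dyz => dyz; [left|right; right].
  by case: z dyz => [|z1 z] // [] // dy; apply: NF; left; right.
- move=> Y s F cF k e hk [ys [zs [hys hzs ->]]]; rewrite /tensor_rs /=.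
  apply: h_add.
  + apply: (cF (fun y => ((k y).1, mone G))
      (fun y => (map (fun z => z y) ys, (k y).2 :: map (fun z => z y) zs))).
      by apply: hom_pair; [apply: hom_fst_comp|apply: hom_const].
    exists ys, ((fun y => (k y).2) :: zs); split=> //; split=> //; exact: hom_snd_comp.
  + case: zs hzs => [|z1 zs] hzs /=; last exact: h_zero modA _ _.
    apply: (cF (fun y => (mone D, mone G)) (fun y => ((k y).1 :: map (fun z => z y) ys, [::]))).
      exact: hom_const.
    exists ((fun y => (k y).1) :: ys), [::]; split=> //; split=> //; exact: hom_fst_comp.
Qed.

(** Each partial differential squares to zero; the mixed terms agree by [bda_comm] up to a sign,
    which is opposite because the [G]-differential lowers the [G]-degree by one. *)
Lemma tensor_rdK F : tensor_rd (tensor_rd F) = fun _ _ => 0.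
Proof.
have [aD lD rD _ _] := monD; have [aG lG rG _ _] := monG.
apply: fext2 => -[d g] [y z]; rewrite /tensor_rd /=.
have bdaN (T : Type) (m : T -> T -> T) n (F1 : T -> seq T -> A) k x :
    bda m (fun k x => sgn n (F1 k x)) 0 k x = sgn n (bda m F1 0 k x).
  by rewrite -(bda_nat _ _ _ _ _ (@sgnB A n)) sgn0.
rewrite !bda_add0 (bdaK aG) add0r.
rewrite (bdaN _ (mmul D) (size z)) (bdaK aD) sgn0 addr0.
case: z => [|z1 z]; first by rewrite /= bda0 sgn0 addr0.
(* Every chain in this [G]-differential has [G]-degree [size z], so the sign is constant. *)
have -> : bda (mmul G) (fun g' z' => sgn (size z')
    (bda (mmul D) (fun d y => F (d, g') (y, z')) 0 d y)) 0 g (z1 :: z) =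
  bda (mmul G) (fun g' z' => sgn (size z)
    (bda (mmul D) (fun d y => F (d, g') (y, z')) 0 d y)) 0 g (z1 :: z).
  by apply: bda_loc => // k w [->].
rewrite bdaN /= sgnS.
have := bda_comm (mmul D) (mmul G) (fun d' y' g' z' => F (d', g') (y', z'))
  (fun _ _ => 0) (fun _ _ => 0) 0 d y g (z1 :: z).
rewrite !bda0 /= => ->.
by rewrite subrr.
Qed.

(** A one-letter word has two empty faces of opposite sign, and longer words have none. This is dual
    to the vanishing of the augmentation on boundaries. *)
Lemma bda_unit_supp (T : Type) (m : T -> T -> T) (c : A) k z1 z :
  bda m (fun _ z => if z is [::] then c else 0) 0 k (z1 :: z) = 0.
Proof. by case: z => [|z2 z] /=; rewrite ?subrr // bda0 !subr0. Qed.

(** For nonempty [z] the [D]-differentials cancel by sign and only the contraction of [G] remains.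
    For empty [z] the term left over by the contraction of [G] is cancelled by that of [D], up to
    the augmentation of the product. *)
Lemma tensor_rdrs (F : fn tensor_resol) : tensor_rs (tensor_rd F) =
  fsub (X := tensor_resol) (fsub F (aug F)) (tensor_rd (tensor_rs F)).
Proof.
have [aD lD rD _ _] := monD; have [aG lG rG _ _] := monG.
apply: fext2 => -[d g] [y z]; apply/eqP; rewrite /fsub eq_sym subr_eq eq_sym; apply/eqP.
have cG := bda_cone lG (fun g z => F (d, g) (y, z)) g z.
case: z cG => [|z1 z] cG.
- have := bda_cone lD (fun d y => F (d, mone G) (y, [::])) d y.
  rewrite /tensor_rd /tensor_rs /aug /fst /snd !bda_add0.
  set u := bda (mmul D) _ _ _ (d :: y); set v := bda (mmul D) _ _ d y => uv.
  have {cG} -> : bda (mmul G) (fun g z => F (d, g) (y, z)) 0 (mone G) [:: g] =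
      F (d, g) (y, [::]) - F (d, mone G) (y, [::]).
    by rewrite /= lG.
  rewrite [sgn _ _]/sgn /=; set w := bda (mmul D) _ _ d y; rewrite !add0r.
  rewrite (addrC w) addrA -[_ + u + v]addrA uv.
  rewrite [_ - w + _]addrAC subrK addrA subrK addn0.
  by case: y {u v w uv}.
- rewrite /tensor_rd /tensor_rs /aug /fst /snd !bda_add0 bda_unit_supp bda0 !addr0.
  rewrite sgnS.
  set u := bda (mmul G) _ _ _ (g :: _) in cG *; set v := bda (mmul G) _ _ g (z1 :: z) in cG *.
  by rewrite addrACA addNr addr0 cG /= addnS.
Qed.

Lemma tensor_resol_ok : resol_ok h tensor_resol.
Proof.
have [aD lD rD _ _] := monD; have [aG lG rG _ _] := monG.
split.
- by [].
- by case=> [[|y1 y] [|z1 z]].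
- by move=> Y s; exists [::], [::].
- move=> Y s e [ys [zs [_ _ ->]]]; exists (size ys + size zs)%N => y.
  by rewrite /= !size_map.
- by case=> [[|y1 y] [|z1 z]] //= [].
- exact: opok_tensor_rd.
- exact: opok_tensor_rs.
- move=> n F F' FF' k [y z] /= syz; rewrite /tensor_rd /=.
  congr (_ + sgn _ _); apply: bda_loc => // k' w sw; apply: FF'; apply/eqP;
    by rewrite -eqSS -(syz : (size y + size z)%N = _) -sw ?addnS ?addSn.
- by move=> F k [[|y1 y] [|z1 z]] //= _; rewrite /tensor_rd /= sgn0 addr0.
- move=> j F; apply: fext2 => k [y z]; rewrite /= /tensor_rd /translate /=.
  congr (_ + sgn _ _); [exact: (bda_mull aG (fun g z => F (mmul D j.1 k.1, g) (y, z)))|].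
  exact: (bda_mull aD (fun d y => F (d, mmul G j.2 k.2) (y, z))).
- move=> a k [[|y1 [|y2 y]] [|z1 [|z2 z]]] //= _; rewrite /tensor_rd /fnul /= subrr;
  by rewrite ?add0r ?sgn0.
- by move=> F; exact: tensor_rdK.
- move=> n F F' FF' k [y z] /= syz; rewrite /tensor_rs /= FF' /= ?addnS; last by congr S.
  by case: z syz => [|z1 z] //= syz; rewrite FF' //=; congr S.
- exact: tensor_rdrs.
Qed.

(** Induction on [p] with [X] free: one factor [D] is absorbed into [X] by pliancy, the remaining
    power is handled over [D x X], and reassociating the product is a morphism. *)
Lemma h_pliant_pow p X (x : Str C X) (phi : powT (mT D) p -> X -> A) :
  (forall y, h x (phi y)) -> h (sprod C (powS (mS D) p) x) (fun t => phi t.1 t.2).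
Proof.
elim: p X x phi => [|p IH] X x phi hphi.
  have := h_comp modA (hom_snd C _ _ (sunit C) x) (hphi tt).
  by rewrite (_ : (fun t => phi t.1 t.2) = fun t => phi tt t.2) //;
    apply: functional_extensionality => -[[] t].
have := IH _ (sprod C (mS D) x) (fun y t => phi (y, t.1) t.2).
have hD y : h (sprod C (mS D) x) (fun t => phi (y, t.1) t.2).
  by case: pliantD => _ pl; apply/pl => d /=; apply: hphi.
move=> /(_ hD).
have hassoc : hom C (sprod C (powS (mS D) p.+1) x) (sprod C (powS (mS D) p) (sprod C (mS D) x))
    (fun t => (t.1.1, (t.1.2, t.2))).
  have h1 := hom_fst C _ _ (powS (mS D) p.+1) x.
  apply: hom_pair; first exact: (hom_comp C _ _ _ _ _ _ _ _ h1 (hom_fst C _ _ _ _)).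
  apply: hom_pair; last exact: hom_snd.
  exact: (hom_comp C _ _ _ _ _ _ _ _ h1 (hom_snd C _ _ _ _)).
move=> /(h_comp modA hassoc) /=.
by rewrite (_ : (fun t => phi t.1 t.2) = fun t => phi (t.1.1, t.1.2) t.2) //;
  apply: functional_extensionality => -[[]].
Qed.

(** * The total complex as functions on the tensor product resolution *)

Definition tensor_lift n (c : totT D G A n) : fn tensor_resol := fun k e =>
  if (size e.1 + size e.2)%N == n then
    act k (c _ _ (pmk (size e.1) (nth (mone D) e.1)) (pmk (size e.2) (nth (mone G) e.2)))
  else 0.

(** Components off the antidiagonal [p + q = n] are zero, as membership in [tot_cplx] requires. *)
Definition tensor_unlift n (F : fn tensor_resol) : totT D G A n := fun p q y x =>
  if (p + q)%N == n then
    F (mone D, mone G) (mkseq (pget (mone D) p y) p, mkseq (pget (mone G) q x) q)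
  else 0.

Lemma tot_ext n (c c' : totT D G A n) : (forall p q y x, c p q y x = c' p q y x) -> c = c'.
Proof.
move=> cc'; do 2 (apply: functional_extensionality_dep => ?).
by apply: fext2; apply: cc'.
Qed.

(** On the antidiagonal each summand is a bar differential in one factor, treated by [cdiff_bda];
    for [q = 0] or [p = 0] the corresponding summand is 0 on both sides. *)
Lemma tensor_cd_unlift n F : equivar act F ->
  totdiff act (tensor_unlift n F) = tensor_unlift n.+1 (tensor_rd F).
Proof.
have [aD lD rD _ _] := monD; have [aG lG rG _ _] := monG => eF.
have eF1 k e : F k e = act k (F (mone D, mone G) e).
  by rewrite -eF /= rD rG -surjective_pairing.
apply: tot_ext => p q y x; rewrite /totdiff /tensor_unlift.
case: ifP => [/eqP pq|/eqP pq].
- rewrite /tensor_rd /= size_mkseq; congr (_ + sgn _ _).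
  + case: q x pq => [|q] x pq //.
    have pq' : (p + q)%N == n by rewrite -eqSS -addnS pq.
    rewrite /vdiff pq'.
    apply: (cdiff_bda monG (F := fun g z => F (mone D, g) (mkseq (pget (mone D) p y) p, z))) => g z.
    by rewrite eF1.
  + case: p y pq => [|p] y pq //.
    have pq' : (p + q)%N == n by rewrite -eqSS -addSn pq.
    rewrite /hdiff pq'.
    apply: (cdiff_bda monD (F := fun d z => F (d, mone G) (z, mkseq (pget (mone G) q x) q))) => g z.
    by rewrite eF1.
- rewrite -[RHS](addr0 0); congr (_ + _).
    case: q x pq => [|q] x pq //; rewrite /vdiff.
    have -> : ((p + q)%N == n) = false by apply/eqP => E; apply: pq; rewrite addnS E.
    by apply: cdiff0 => g; apply: (act0 modA).
  rewrite -[RHS](sgn0 A q); congr sgn.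
  case: p y pq => [|p] y pq //; rewrite /hdiff.
  have -> : ((p + q)%N == n) = false by apply/eqP => E; apply: pq; rewrite addSn E.
  by apply: cdiff0 => g; apply: (act0 modA).
Qed.

Lemma tensor_member_lift n c : cmem (tot_cplx act h) n c -> member act h (tensor_lift (n := n) c).
Proof.
have actM k k' a : act (mmul (prodMon D G) k k') a = act k (act k' a) by case: modA => [[_ []]].
case=> bc c0; split.
- by move=> j k e; rewrite /tensor_lift; case: ifP => _; rewrite ?actM ?(act0 modA).
- move=> k [y z] dyz; rewrite /tensor_lift /=; case: eqP => // /bc [cc nc].
  suff -> : c _ _ (pmk (size y) (nth (mone D) y)) (pmk (size z) (nth (mone G) z)) = 0.
    exact: (act0 modA).
  case: dyz => /= dyz; have [i [lt_i ei]] := In_nth dyz.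
  + by apply: nc; exists i; split=> //; rewrite pget_pmk.
  + by apply: (cc _).2; exists i; split=> //; rewrite pget_pmk.
- move=> Y s k e hk [ys [zs [hys hzs ->]]].
  have -> : (fun y => tensor_lift (n := n) c (k y) (map (fun z => z y) ys, map (fun z => z y) zs)) =
    (fun y => if (size ys + size zs)%N == n then
      act (k y) (c (size ys) (size zs) (pmk (size ys) (nth (mone D) (map (fun z => z y) ys)))
        (pmk (size zs) (nth (mone G) (map (fun z => z y) zs)))) else 0).
    by apply: functional_extensionality => y; rewrite /tensor_lift /= !size_map.
  case: eqP => [/bc [cc _]|_]; last exact: h_zero modA _ _.
  have [_ [_ [_ [_ hact]]]] := modA.
  have hp := hom_pair _ _ _ _ _ _ _ _ _ hk (hom_pair _ _ _ _ _ _ _ _ _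
    (hom_pmk (size ys) (fun i => hom_nth (mone D) i hys))
    (hom_pmk (size zs) (fun i => hom_nth (mone G) i hzs))).
  (* Pliancy turns the family of cochains on [G] into one element of [h] on the product of both
     powers, to which the action axiom applies. *)
  exact: (h_comp modA hp (hact _ _ _ (h_pliant_pow (fun y => (cc y).1)))).
Qed.

Lemma tensor_cmem_unlift n F : member act h F -> cmem (tot_cplx act h) n (tensor_unlift n F).
Proof.
move=> [eF nF cF]; split=> p q /eqP pq; last by move=> y x; rewrite /tensor_unlift (negPf pq).
rewrite /tensor_unlift pq; split; last first.
  by move=> y hy x; apply: nF; left; apply/In_mkseq.
move=> y; split; last by move=> x hx; apply: nF; right; apply/In_mkseq.
apply: (cF _ (powS (mS G) q) (fun _ => (mone D, mone G))
  (fun x => (mkseq (pget (mone D) p y) p, mkseq (pget (mone G) q x) q))).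
  exact: hom_const.
exists (mkseq (fun i x => pget (mone D) p y i) p), (mkseq (fun i x => pget (mone G) q x i) q).
split.
(* The point [y] is fixed, so the entries in [D] are constant morphisms. *)
- by apply: hom_seq_mkseq => i _; apply: hom_const.
- by apply: hom_seq_mkseq => i _; apply: hom_pget.
- by apply: functional_extensionality => x; rewrite !map_mkseq_at.
Qed.

Definition tensor_model : model act h tensor_resol (tot_cplx act h).
Proof.
have [aD lD rD _ _] := monD; have [aG lG rG _ _] := monG.
have act1 a : act (mone D, mone G) a = a by case: modA => [[_ []]].
have actD k a b : act k (a + b) = act k a + act k b by case: modA => [[? []]].
apply: (@Model _ _ _ act h tensor_resol (tot_cplx act h) tensor_lift tensor_unlift).
- exact: tensor_member_lift.
- exact: tensor_cmem_unlift.
- move=> n c [_ c0]; apply: tot_ext => p q y x; rewrite /tensor_unlift /tensor_lift.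
  case: ifP => [pq|/eqP pq]; last by rewrite c0.
  by rewrite /= !size_mkseq pq act1 !pmk_nth_mkseq.
- move=> n F F' FF'; apply: tot_ext => p q y x; rewrite /tensor_unlift.
  by case: eqP => // pq; apply: FF'; rewrite /= !size_mkseq.
- move=> n F eF k [y z] /= yz; rewrite /tensor_lift /tensor_unlift /= yz eqxx.
  by rewrite !mkseq_pget_pmk !mkseq_nth -eF /= rD rG -surjective_pairing.
- by move=> n F eF; apply: tensor_cd_unlift.
- move=> n c c'; apply: fext2 => k e; rewrite /fadd /tensor_lift /=.
  by case: ifP => _; rewrite ?actD ?addr0.
- move=> n F F'; apply: tot_ext => p q y x; rewrite /tensor_unlift /= /fadd.
  by case: ifP => _; rewrite ?addr0.
- move=> n F; apply: tot_ext => p q y x; rewrite /tensor_unlift /= /fsub /fnul.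
  by case: ifP => _; rewrite ?sub0r ?oppr0.
- by move=> n; apply: tot_ext => p q y x; rewrite /tensor_unlift; case: ifP.
Defined.
End TensorResolution.

(** * Iterated products of monoid objects, and the comparison of the two complexes *)

Lemma monoid_obj_prods C (G' : MonData C) (Ms : seq (MonData C)) :
  is_monoid_obj G' ->
  (forall i, (i < size Ms)%N -> is_monoid_obj (nth G' Ms i)) ->
  is_monoid_obj (prodMons G' Ms).
Proof.
(* The accumulator of the [foldl] is generalised for the induction, while the default of [nth] stays
   [G']. *)
move=> monG; rewrite /prodMons; move: {1 3}G' monG => G monG.
elim: Ms G monG => [|M Ms IH] G monG monMs //=.
by apply: IH => [|i lti]; [apply: monoid_obj_prod => //; apply: (monMs 0%N)|apply: (monMs i.+1)].
Qed.

Theorem theorem11p6 (C : TopCat) (G' : MonData C) (Ms : seq (MonData C))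
    (D : MonData C) (A : zmodType)
    (act : mT (prodMon D (prodMons G' Ms)) -> A -> A)
    (h : forall T, Str C T -> (T -> A) -> Prop) :
  is_group_obj G' ->
  (forall i, (i < size Ms)%N -> is_abelian_monoid_obj (nth G' Ms i)) ->
  is_discrete_abelian_monoid D ->
  rigid_module act h ->
  pliant D h ->
  exists phi, quasi_iso (group_cplx act h) (tot_cplx act h) phi.
Proof.
move=> [monG' _] monMs [[monD _] _] modA pliantD.
have monG : is_monoid_obj (prodMons G' Ms).
  by apply: monoid_obj_prods => // i /monMs [].
have monK := monoid_obj_prod monD monG.
apply: (quasi_iso_of_resolutions monK modA).
- exact: (bar_resol_ok monK modA).
- exact: (tensor_resol_ok monD monG modA).
- exact: bar_model.
- exact: tensor_model.
Qed.
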